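(* Let $\alpha>0$, $A\ge0$, $B>0$, $t>0$, $w(x,t)=x^\alpha e^{-x}(A+B\theta(x-t))$ on $[0,\infty)$, and $D_n(t)=\det\left(\int_0^\infty x^{i+j}w(x,t)dx\right)_{i,j=0}^{n-1}$ (with $D_0:=1$). Then for $n\ge1$ $$t^2\frac{d^2}{dt^2}\ln D_n(t)=-n(n+\alpha)+\frac{D_{n+1}(t)D_{n-1}(t)}{D_n(t)^2}.$$
   Context: $\theta$ is the Heaviside function ($1$ for $x>0$, $0$ otherwise). *)

(* Defs.v *)
From Stdlib Require Import Reals.
From Coquelicot Require Import Coquelicot.
From mathcomp Require Import all_boot all_algebra.
From mathcomp Require Import Rstruct.

Open Scope R_scope.

(* x^a for real a, on x > 0 (value at x <= 0 set to 0; irrelevant for integrals) *)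
Definition rpow (x a : R) : R := if Rlt_dec 0 x then Rpower x a else 0.

Definition heaviside (x : R) : R := if Rlt_dec 0 x then 1 else 0.

Definition weight (alpha A B t x : R) : R :=
  rpow x alpha * exp (- x) * (A + B * heaviside (x - t)).

Definition moment (alpha A B : R) (k : nat) (t : R) : R :=
  RInt_gen (fun x => x ^ k * weight alpha A B t x)
           (at_point 0) (Rbar_locally p_infty).

(* D_n(t) = det (mu_{i+j}(t))_{i,j=0}^{n-1}; D_0 = det of empty matrix = 1 *)
Definition hankelD (alpha A B : R) (n : nat) (t : R) : R :=
  (\det (\matrix_(i < n, j < n) moment alpha A B (i + j)%N t))%R.

(* Main.v *)
(* With G_k(t) the integral of x^(k+alpha) e^-x over [0, t], the moments are
   mu_k(t) = (A + B) G_k(oo) - B G_k(t), and integration by parts gives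
   t mu_k' = (k+1+alpha) mu_k - mu_(k+1). Hence nu_k = (-1)^k t^-(k+1+alpha) mu_k
   satisfies nu_k' = nu_(k+1), and its Hankel determinants are
   H_n = t^(-n(n+alpha)) D_n. Differentiating H_n bumps the index of its last row,
   differentiating again that of its last column, so the Desnanot-Jacobi identity
   reads H_n H_n'' - H_n'^2 = H_(n+1) H_(n-1), which is the claim for ln H_n.
   Positivity of the D_n follows from that of the quadratic form
   v |-> int (sum_i v_i x^i)^2 w. *)
Require Import Defs.
From Stdlib Require Import Reals Lra.
From Coquelicot Require Import Coquelicot.
From mathcomp Require Import all_boot all_order all_algebra.
From mathcomp Require Import perm Rstruct.
Open Scope R_scope.

(** * Moments *)

(* Coquelicot leaves equations at the carrier of a structure on [R], where [ring]
   and [field] do not recognise the type. *)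
Ltac real_eq := match goal with |- @eq _ ?x ?y => change (@eq R x y) end.

Ltac unfold_ops :=
  unfold Hierarchy.minus, Hierarchy.plus, Hierarchy.opp, Hierarchy.scal,
    Hierarchy.mult, Hierarchy.zero; simpl; unfold Hierarchy.mult; simpl; real_eq.

Lemma continuous_rpow (a x : R) : 0 < a -> continuous (fun y => rpow y a) x.
Proof.
intros Ha.
destruct (Rtotal_order x 0) as [Hx | [-> | Hx]].
- apply (continuous_ext_loc _ (fun _ => 0)); [|apply continuous_const].
  exists (mkposreal (- x) ltac:(lra)); intros y Hy.
  assert (Hy' : Rabs (y - x) < - x) by exact Hy.
  apply Rabs_def2 in Hy'.
  unfold rpow; destruct (Rlt_dec 0 y); [lra|reflexivity].
- apply filterlim_locally; intros eps.
  (* The radius solves [delta^a = eps]. *)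
  assert (Hd : 0 < Rpower eps (/ a)) by apply exp_pos.
  exists (mkposreal _ Hd); intros y Hy.
  assert (Hy' : Rabs (y - 0) < Rpower eps (/ a)) by exact Hy.
  change (Rabs (rpow y a - rpow 0 a) < eps).
  replace (rpow 0 a) with 0 by (unfold rpow; destruct (Rlt_dec 0 0); [lra|easy]).
  unfold rpow; destruct (Rlt_dec 0 y) as [H|H].
  + rewrite !Rminus_0_r in Hy' |- *.
    rewrite Rabs_pos_eq in Hy'; [|lra].
    rewrite Rabs_pos_eq; [|left; apply exp_pos].
    replace (pos eps) with (Rpower (Rpower eps (/ a)) a).
    * apply Rlt_Rpower_l; lra.
    * rewrite Rpower_mult Rinv_l; [|lra].
      apply Rpower_1, cond_pos.
  + rewrite Rminus_0_r Rabs_R0; apply cond_pos.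
- apply (continuous_ext_loc _ (fun y => Rpower y a)).
  + exists (mkposreal x Hx); intros y Hy.
    assert (Hy' : Rabs (y - x) < x) by exact Hy.
    apply Rabs_def2 in Hy'.
    unfold rpow; destruct (Rlt_dec 0 y); [reflexivity|lra].
  + apply (ex_derive_continuous (fun y => Rpower y a)).
    unfold Rpower; auto_derive; lra.
Qed.

(** * Incomplete and complete gamma integrals *)

Definition gamma_density (a : R) (k : nat) (x : R) : R :=
  x ^ k * rpow x a * exp (- x).

Definition lower_gamma (a : R) (k : nat) (x : R) : R :=
  RInt (gamma_density a k) 0 x.

Lemma continuous_gamma_density (a x : R) (k : nat) :
  0 < a -> continuous (gamma_density a k) x.
Proof.
intros Ha.
apply (continuous_mult (fun y => y ^ k * rpow y a) (fun y => exp (- y))).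
- apply (continuous_mult (fun y => y ^ k) (fun y => rpow y a)).
  + apply (ex_derive_continuous (fun y => y ^ k)); auto_derive; easy.
  + now apply continuous_rpow.
- apply (ex_derive_continuous (fun y => exp (- y))); auto_derive; easy.
Qed.

Lemma is_RInt_gamma_density (a x y : R) (k : nat) : 0 < a ->
  is_RInt (gamma_density a k) x y (lower_gamma a k y - lower_gamma a k x).
Proof.
intros Ha.
assert (E : forall u v, ex_RInt (gamma_density a k) u v).
{ intros u v; apply (ex_RInt_continuous (V := R_CompleteNormedModule)); intros; now apply continuous_gamma_density. }
replace (lower_gamma a k y - lower_gamma a k x)
  with (RInt (gamma_density a k) x y); [now apply (RInt_correct (V := R_CompleteNormedModule))|].
unfold lower_gamma; rewrite -(RInt_Chasles (gamma_density a k) 0 x y) //.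
unfold_ops; lra.
Qed.

Lemma is_derive_lower_gamma (a x : R) (k : nat) :
  0 < a -> is_derive (lower_gamma a k) x (gamma_density a k x).
Proof.
intros Ha.
apply (is_derive_RInt _ _ 0); [|now apply continuous_gamma_density].
apply filter_forall; intros y.
apply (RInt_correct (V := R_CompleteNormedModule)), (ex_RInt_continuous (V := R_CompleteNormedModule)); intros; now apply continuous_gamma_density.
Qed.

Lemma lower_gamma0 (a : R) (k : nat) : lower_gamma a k 0 = 0.
Proof. apply (RInt_point 0 (gamma_density a k)). Qed.

Lemma pow_mult_Rpower (x a : R) (k : nat) :
  0 < x -> x ^ k * Rpower x a = Rpower x (INR k + a).
Proof. intros Hx; now rewrite Rpower_plus Rpower_pow. Qed.

Lemma gamma_density_Rpower (a x : R) (k : nat) : 0 < x ->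
  gamma_density a k x = Rpower x (INR k + a) * exp (- x).
Proof.
intros Hx; unfold gamma_density, rpow.
destruct (Rlt_dec 0 x); [|lra]. now rewrite pow_mult_Rpower.
Qed.

Lemma gamma_density_pos (a x : R) (k : nat) : 0 < x -> 0 < gamma_density a k x.
Proof.
intros Hx; rewrite gamma_density_Rpower //.
apply Rmult_lt_0_compat; apply exp_pos.
Qed.

(** One half of the exponential absorbs the power, since [x^b e^(-x/2)] peaks at [x = 2 b]; the
    other half stays as an integrable majorant. The factor [e^(-b)] of the sharp constant is
    dropped. *)
Lemma Rpower_exp_bound (b x : R) : 0 < b -> 0 < x ->
  Rpower x b * exp (- x) <= Rpower (2 * b) b * exp (- x / 2).
Proof.
intros Hb Hx.
assert (Hy : 0 < x / (2 * b)) by (apply Rdiv_lt_0_compat; lra).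
unfold Rpower; rewrite -!exp_plus.
apply Rnot_lt_le; intros H'; apply exp_lt_inv in H'; revert H'; apply Rle_not_lt.
(* [ln y <= y - 1] at [y = x / (2 b)]. *)
assert (H := exp_ineq1_le (ln (x / (2 * b)))).
rewrite exp_ln in H; [|easy].
rewrite ln_div in H; try lra.
assert (H2 : b * (1 + (ln x - ln (2 * b))) <= b * (x / (2 * b)))
  by (apply Rmult_le_compat_l; lra).
replace (b * (x / (2 * b))) with (x / 2) in H2 by (field; lra).
lra.
Qed.

Lemma incr_of_derive (f df : R -> R) (a b : R) : a <= b ->
  (forall x, is_derive f x (df x)) ->
  (forall x, a < x < b -> 0 <= df x) -> f a <= f b.
Proof.
intros Hab Hd Hp.
destruct Hab as [Hab | ->]; [|lra].
destruct (MVT_cor2 f df a b Hab) as (c & Hc & Hcab).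
- intros c _; apply is_derive_Reals, Hd.
- specialize (Hp c Hcab).
  assert (0 <= df c * (b - a)) by (apply Rmult_le_pos; lra). lra.
Qed.

Lemma lower_gamma_incr (a x y : R) (k : nat) : 0 < a -> 0 <= x <= y ->
  lower_gamma a k x <= lower_gamma a k y.
Proof.
intros Ha Hxy.
apply (incr_of_derive _ (gamma_density a k)); [lra| |].
- intros; now apply is_derive_lower_gamma.
- intros z Hz; left; apply gamma_density_pos; lra.
Qed.

Lemma lower_gamma_bounded (a : R) (k : nat) : 0 < a ->
  exists M, forall x, 0 <= x -> lower_gamma a k x <= M.
Proof.
intros Ha.
assert (Hk := pos_INR k).
set (C := Rpower (2 * (INR k + a)) (INR k + a)).
(* The integral of the majorant [C e^(-x/2)] over the half-line is [2 C]; [f] below is nondecreasing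
   because its derivative is the majorant minus the density. *)
exists (2 * C); intros x Hx.
assert (HC : 0 < C) by apply exp_pos.
pose (f := fun y => - lower_gamma a k y - 2 * C * exp (- y / 2)).
assert (f 0 <= f x).
{ apply (incr_of_derive _ (fun y => - gamma_density a k y + C * exp (- y / 2))); [easy| |].
  - intros y; unfold f.
    evar_last.
    + apply (is_derive_minus (fun y => - lower_gamma a k y)
              (fun y => 2 * C * exp (- y / 2))).
      * apply (is_derive_opp (lower_gamma a k)); now apply is_derive_lower_gamma.
      * auto_derive; [easy|reflexivity].
    + unfold_ops. unfold Rdiv; field.
  - intros y Hy.
    rewrite gamma_density_Rpower; [|lra].
    assert (H := Rpower_exp_bound (INR k + a) y ltac:(lra) ltac:(lra)).
    fold C in H; lra. }
unfold f in H; rewrite lower_gamma0 in H.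
assert (0 < C * exp (- x / 2)) by (apply Rmult_lt_0_compat; [easy|apply exp_pos]).
replace (- 0 / 2) with 0 in H by field.
rewrite exp_0 in H; lra.
Qed.

(** Monotone convergence: the limit is the supremum of the values on the half-line. *)
Lemma lower_gamma_cvg (a : R) (k : nat) : 0 < a ->
  exists l : R, filterlim (lower_gamma a k) (Rbar_locally p_infty) (locally l).
Proof.
intros Ha.
destruct (lower_gamma_bounded a k Ha) as [M HM].
destruct (completeness (fun y => exists x, 0 <= x /\ y = lower_gamma a k x))
  as [l [Hub Hlub]].
- exists M; intros y (x & Hx & ->); now apply HM.
- exists (lower_gamma a k 0), 0; split; [lra|easy].
- exists l; apply filterlim_locally; intros eps.
  assert (exists x0, 0 <= x0 /\ l - eps < lower_gamma a k x0) as (x0 & Hx0 & Hl).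
  { apply Classical_Prop.NNPP; intros N.
    assert (l <= l - eps); [|destruct eps; simpl in *; lra].
    apply Hlub; intros y (x & Hx & ->).
    apply Rnot_lt_le; intros Hlt; apply N; now exists x. }
  exists x0; intros x Hx.
  change (Rabs (lower_gamma a k x - l) < eps).
  assert (lower_gamma a k x0 <= lower_gamma a k x) by (apply lower_gamma_incr; lra).
  assert (lower_gamma a k x <= l) by (apply Hub; exists x; split; [lra|easy]).
  apply Rabs_def1; destruct eps; simpl in *; lra.
Qed.

(** For [a > 0] this is Euler's Gamma at [k + 1 + a]. *)
Definition complete_gamma (a : R) (k : nat) : R :=
  real (Lim (lower_gamma a k) p_infty).

Lemma is_lim_lower_gamma (a : R) (k : nat) : 0 < a ->
  is_lim (lower_gamma a k) p_infty (complete_gamma a k).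
Proof.
intros Ha; destruct (lower_gamma_cvg a k Ha) as [l Hl].
assert (H : is_lim (lower_gamma a k) p_infty l) by exact Hl.
unfold complete_gamma; now rewrite (is_lim_unique _ _ _ H).
Qed.

(** * The moments in terms of gamma integrals *)

Lemma moment_eq (a A B t : R) (k : nat) : 0 < a -> 0 < t ->
  moment a A B k t = (A + B) * complete_gamma a k - B * lower_gamma a k t.
Proof.
intros Ha Ht.
apply (is_RInt_gen_unique (Fa := at_point 0) (Fb := Rbar_locally p_infty)).
assert (Hlim : is_lim (fun b => (A + B) * lower_gamma a k b - B * lower_gamma a k t) p_infty
  ((A + B) * complete_gamma a k - B * lower_gamma a k t)).
{ eapply is_lim_minus.
  - apply is_lim_scal_l, is_lim_lower_gamma, Ha.
  - apply is_lim_const.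
  - easy. }
intros P HP.
specialize (Hlim P HP).
assert (Hb : forall b, t < b ->
  is_RInt (fun x => x ^ k * weight a A B t x) 0 b
    ((A + B) * lower_gamma a k b - B * lower_gamma a k t)).
{ intros b Hb.
  replace ((A + B) * lower_gamma a k b - B * lower_gamma a k t)
    with (plus (scal A (lower_gamma a k t - lower_gamma a k 0))
               (scal (A + B) (lower_gamma a k b - lower_gamma a k t))).
  2: { rewrite lower_gamma0; unfold_ops; ring. }
  (* The weight has the constant factor [A] before the jump at [t] and [A + B] after it.
     Extensionality is only checked on open intervals, so the value at [t] itself does not
     matter. *)
  apply (is_RInt_Chasles (V := R_NormedModule) _ 0 t b).
  - apply (is_RInt_ext (V := R_NormedModule) (fun x => scal A (gamma_density a k x))).
    + intros x; rewrite Rmin_left; [|lra]; rewrite Rmax_right; [|lra]; intros Hx.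
      unfold weight, gamma_density, heaviside; unfold_ops.
      destruct (Rlt_dec 0 (x - t)); simpl; [lra|ring].
    + now apply (is_RInt_scal (V := R_NormedModule) (gamma_density a k)), is_RInt_gamma_density.
  - apply (is_RInt_ext (V := R_NormedModule) (fun x => scal (A + B) (gamma_density a k x))).
    + intros x; rewrite Rmin_left; [|lra]; rewrite Rmax_right; [|lra]; intros Hx.
      unfold weight, gamma_density, heaviside; unfold_ops.
      destruct (Rlt_dec 0 (x - t)); simpl; [ring|lra].
    + now apply (is_RInt_scal (V := R_NormedModule) (gamma_density a k)), is_RInt_gamma_density. }
(* The lower bound is pinned at 0, and only upper bounds beyond the jump are considered. *)
apply (Filter_prod _ _ _ (fun x => x = 0) (fun b => t < b /\
  P ((A + B) * lower_gamma a k b - B * lower_gamma a k t))).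
- easy.
- apply filter_and; [|exact Hlim]. now exists t.
- intros x y -> [Hty HPy]; eexists; split; [|exact HPy]; now apply Hb.
Qed.

Lemma is_derive_moment (a A B t : R) (k : nat) : 0 < a -> 0 < t ->
  is_derive (moment a A B k) t (- B * gamma_density a k t).
Proof.
intros Ha Ht.
apply (is_derive_ext_loc
  (fun s => (A + B) * complete_gamma a k - B * lower_gamma a k s)).
- exists (mkposreal t Ht); intros y Hy.
  assert (Hy' : Rabs (y - t) < t) by exact Hy.
  apply Rabs_def2 in Hy'.
  rewrite moment_eq //; lra.
- evar_last.
  + apply (is_derive_minus (fun _ => (A + B) * complete_gamma a k)
      (fun s => B * lower_gamma a k s)).
    * apply is_derive_const.
    * apply is_derive_scal, is_derive_lower_gamma, Ha.
  + unfold_ops; ring.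
Qed.

(** * Recurrences from integration by parts *)

Lemma eq_at_0_of_derive_0 (f : R -> R) :
  (forall x, continuous f x) ->
  (forall x, 0 < x -> is_derive f x 0) -> forall x, 0 <= x -> f x = f 0.
Proof.
intros Hc Hd x [Hx|<-]; [|easy].
destruct (MVT_gen f 0 x (fun _ => 0)) as (c & _ & Hfc).
- intros y; rewrite Rmin_left; [|lra]; intros [Hy _]; now apply Hd.
- intros y _; now apply continuity_pt_filterlim, Hc.
- lra.
Qed.

Lemma gamma_density_S (a x : R) (k : nat) :
  gamma_density a (S k) x = x * gamma_density a k x.
Proof. unfold gamma_density; simpl; ring. Qed.

Lemma is_derive_gamma_density_S (a x : R) (k : nat) : 0 < x ->
  is_derive (gamma_density a (S k)) x
    ((INR k + 1 + a) * gamma_density a k x - gamma_density a (S k) x).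
Proof.
intros Hx.
apply (is_derive_ext_loc (fun y => exp ((INR (S k) + a) * ln y) * exp (- y))).
- exists (mkposreal x Hx); intros y Hy.
  assert (Hy' : Rabs (y - x) < x) by exact Hy.
  apply Rabs_def2 in Hy'.
  rewrite gamma_density_Rpower //; lra.
- rewrite gamma_density_S gamma_density_Rpower // S_INR.
  unfold Rpower.
  auto_derive; [easy|].
  replace ((INR k + 1 + a) * ln x) with (ln x + (INR k + a) * ln x) by ring.
  rewrite exp_plus exp_ln //; field; lra.
Qed.

(** Integration by parts, verified by differentiation: both sides vanish at 0 and have equal
    derivatives for positive arguments. *)
Lemma lower_gamma_S (a x : R) (k : nat) : 0 < a -> 0 <= x ->
  lower_gamma a (S k) x =
    (INR k + 1 + a) * lower_gamma a k x - gamma_density a (S k) x.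
Proof.
intros Ha Hx.
pose (f := fun y => lower_gamma a (S k) y -
  ((INR k + 1 + a) * lower_gamma a k y - gamma_density a (S k) y)).
assert (H : f x = f 0).
{ apply eq_at_0_of_derive_0; [| |easy].
  - intros y.
    apply (continuous_minus (lower_gamma a (S k))
      (fun y => (INR k + 1 + a) * lower_gamma a k y - gamma_density a (S k) y)).
    + apply (ex_derive_continuous (lower_gamma a (S k))).
      eexists; now apply is_derive_lower_gamma.
    + apply (continuous_minus (fun y => (INR k + 1 + a) * lower_gamma a k y)
        (gamma_density a (S k))); [|now apply continuous_gamma_density].
      apply (ex_derive_continuous (fun y => (INR k + 1 + a) * lower_gamma a k y)).
      eexists; now apply is_derive_scal, is_derive_lower_gamma.
  - intros y Hy; evar_last.
    + apply (is_derive_minus (lower_gamma a (S k))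
        (fun y => (INR k + 1 + a) * lower_gamma a k y - gamma_density a (S k) y)).
      * now apply is_derive_lower_gamma.
      * apply (is_derive_minus (fun y => (INR k + 1 + a) * lower_gamma a k y)
          (gamma_density a (S k))).
        -- now apply is_derive_scal, is_derive_lower_gamma.
        -- now apply is_derive_gamma_density_S.
    + unfold_ops; ring. }
unfold f in H; rewrite !lower_gamma0 (gamma_density_S a 0) Rmult_0_l in H; lra.
Qed.

Lemma is_lim_gamma_density (a : R) (k : nat) : 0 < a ->
  is_lim (gamma_density a k) p_infty 0.
Proof.
intros Ha.
assert (Hk := pos_INR k).
set (C := Rpower (2 * (INR k + a)) (INR k + a)).
apply (is_lim_le_le_loc (fun _ => 0) (fun x => C * exp (- x / 2))).
- exists 0; intros x Hx; split.
  + left; now apply gamma_density_pos.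
  + rewrite gamma_density_Rpower //; apply Rpower_exp_bound; lra.
- apply is_lim_const.
- replace (Rbar.Finite 0) with (Rbar_mult C 0) by (simpl; f_equal; ring).
  apply is_lim_scal_l.
  apply (is_lim_comp exp (fun x => - x / 2) p_infty 0 m_infty).
  + apply is_lim_exp_m.
  + apply (is_lim_ext (fun x => - / 2 * x)); [intros; field|].
    evar_last; [apply is_lim_scal_l, is_lim_id|].
    simpl; destruct (Rle_dec 0 (- / 2)); [exfalso; lra|easy].
  + now exists 0.
Qed.

(** The functional equation of Gamma: the boundary term of [lower_gamma_S] vanishes at infinity. *)
Lemma complete_gamma_S (a : R) (k : nat) : 0 < a ->
  complete_gamma a (S k) = (INR k + 1 + a) * complete_gamma a k.
Proof.
intros Ha.
assert (H : is_lim (lower_gamma a (S k)) p_infty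
  ((INR k + 1 + a) * complete_gamma a k - 0)).
{ apply (is_lim_ext_loc
    (fun x => (INR k + 1 + a) * lower_gamma a k x - gamma_density a (S k) x)).
  - exists 0; intros x Hx; rewrite lower_gamma_S //; lra.
  - eapply is_lim_minus.
    + now apply is_lim_scal_l, is_lim_lower_gamma.
    + now apply is_lim_gamma_density.
    + easy. }
apply is_lim_unique in H.
unfold complete_gamma at 1; rewrite H; simpl; ring.
Qed.

(** The jump of the weight leaves a boundary term at [t], which equals [- t] times the derivative of
    the [k]-th moment. *)
Lemma moment_S (a A B t : R) (k : nat) : 0 < a -> 0 < t ->
  moment a A B (S k) t =
    (INR k + 1 + a) * moment a A B k t + B * gamma_density a (S k) t.
Proof.
intros Ha Ht.
rewrite !moment_eq // complete_gamma_S // lower_gamma_S //; [ring|lra].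
Qed.

(** * Scaled moments *)

Definition scaled_moment (a A B : R) (k : nat) (t : R) : R :=
  (- 1) ^ k * Rpower t (- (INR k + 1 + a)) * moment a A B k t.

(* Multiplying by [t^-(k+1+a)] absorbs the diagonal term of
   [t mu_k' = (k+1+a) mu_k - mu_(k+1)]. *)
Lemma is_derive_scaled_moment (a A B t : R) (k : nat) : 0 < a -> 0 < t ->
  is_derive (scaled_moment a A B k) t (scaled_moment a A B (S k) t).
Proof.
intros Ha Ht.
evar_last.
- apply (is_derive_mult (fun s => (- 1) ^ k * Rpower s (- (INR k + 1 + a)))
    (moment a A B k)).
  + apply is_derive_scal.
    assert (H : is_derive (fun s => Rpower s (- (INR k + 1 + a))) t
      (- (INR k + 1 + a) / t * Rpower t (- (INR k + 1 + a)))).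
    { unfold Rpower; auto_derive; [easy|field; lra]. }
    exact H.
  + now apply is_derive_moment.
  + intros; apply Rmult_comm.
- unfold scaled_moment; unfold_ops.
  rewrite moment_S // gamma_density_S.
  rewrite -/(INR (S k)) S_INR.
  replace (- (INR k + 1 + 1 + a)) with (- (1) + - (INR k + 1 + a)) by ring.
  rewrite (Rpower_plus (- (1))) (Rpower_Ropp t 1) Rpower_1 //.
  field; lra.
Qed.

(** * Determinants *)

Set Implicit Arguments.
Unset Strict Implicit.

Section HankelDeterminants.
Import Order.TTheory GRing.Theory Num.Theory.
Local Open Scope ring_scope.

(** Block elimination: the matrix is a block lower triangular factor times a block upper triangular
    one, whose last diagonal block is the Schur complement. *)
Lemma det_block_schur (F : fieldType) (m p : nat) (M : 'M[F]_m) (U : 'M[F]_(m, p))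
    (L : 'M[F]_(p, m)) (Q : 'M[F]_p) : M \in unitmx ->
  \det (block_mx M U L Q) = \det M * \det (Q - L *m invmx M *m U).
Proof.
move=> uM.
have -> : block_mx M U L Q =
    block_mx M 0 L 1%:M *m block_mx 1%:M (invmx M *m U) 0 (Q - L *m invmx M *m U).
  rewrite mulmx_block !mul0mx !mulmx0 !mulmx1 !mul1mx !addr0 mulmxA mulmxV //.
  by rewrite mul1mx mulmxA addrCA subrr addr0.
by rewrite det_mulmx det_lblock det_ublock !det1 mulr1 mul1r.
Qed.

(** Separate index maps for rows and columns let one family hold the Hankel determinants (both maps
    [id]) and their derivatives, where a last index is raised. *)
Definition gen_hankel (F : fieldType) (c : nat -> F) (n : nat) (a b : nat -> nat) : F :=
  \det (\matrix_(i < n, j < n) c (a i + b j)%N).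

Definition bump_last (n : nat) (i : nat) : nat := if i == n then i.+1 else i.

Lemma gen_hankel_sym (F : fieldType) (c : nat -> F) n a b :
  gen_hankel c n a b = gen_hankel c n b a.
Proof.
rewrite /gen_hankel -det_tr; congr (\det _); apply/matrixP => i j.
by rewrite !mxE addnC.
Qed.

Section Jacobi.
Variables (F : fieldType) (c : nat -> F) (m : nat).

Let M : 'M[F]_m := \matrix_(i, j) c (i + j)%N.
Let col_of k : 'cV[F]_m := \col_i c (i + k)%N.
Let row_of k : 'rV[F]_m := \row_i c (k + i)%N.
(* Entries of the Schur complement of [M] in any larger Hankel matrix. *)
Let schur k l : F := c (k + l)%N - (row_of k *m invmx M *m col_of l) 0 0.

Hypothesis uM : M \in unitmx.

Lemma gen_hankel_schur1 (a b : nat -> nat) :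
  (forall i, (i < m)%N -> a i = i) -> (forall i, (i < m)%N -> b i = i) ->
  gen_hankel c m.+1 a b = \det M * schur (a m) (b m).
Proof.
move=> ha hb; rewrite -addn1 /gen_hankel.
have -> : \matrix_(i < m + 1, j < m + 1) c (a i + b j)%N =
    block_mx M (col_of (b m)) (row_of (a m)) (c (a m + b m)%N)%:M.
  rewrite -[LHS]submxK; congr block_mx; apply/matrixP => i j; rewrite !mxE /=.
  - by rewrite ha // hb.
  - by rewrite ha // ord1 addn0.
  - by rewrite hb // ord1 addn0.
  - by rewrite !ord1 addn0 eqxx mulr1n.
by rewrite det_block_schur // det_mx11 /schur !mxE eqxx mulr1n.
Qed.

Lemma gen_hankel_schur2 : gen_hankel c m.+2 id id =
  \det M * (schur m m * schur m.+1 m.+1 - schur m m.+1 * schur m.+1 m).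
Proof.
rewrite -addn2 /gen_hankel.
have -> : \matrix_(i < m + 2, j < m + 2) c (i + j)%N =
    block_mx M (\matrix_(i, j) c (i + (m + j))%N) (\matrix_(i, j) c (m + i + j)%N)
      (\matrix_(i, j) c (m + i + (m + j))%N).
  by rewrite -[LHS]submxK; congr block_mx; apply/matrixP => i j; rewrite !mxE /=.
rewrite det_block_schur //; congr (_ * _).
set S := _ - _.
have SE i j : S i j = schur (m + i) (m + j).
  rewrite /S /schur !mxE; congr (_ - _); apply: eq_bigr => k _.
  rewrite !mxE; congr (_ * _); apply: eq_bigr => l _; by rewrite !mxE.
move: S SE => S SE.
rewrite (expand_det_row _ 0) big_ord_recl big_ord1 /cofactor !det_mx11 !mxE !SE /=.
by rewrite /bump /= !addn0 !addn1 expr0 mul1r expr1 mulN1r mulrN.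
Qed.

Lemma bump_last_lt i : (i < m)%N -> bump_last m i = i.
Proof. by rewrite /bump_last; case: eqP => // ->; rewrite ltnn. Qed.

(** All the determinants share the leading block [M]. With [d = \det M] and the 2 by 2 Schur
    complement with rows [x y] and [z w], both sides equal [d^2 (x w - y z)]. *)
Lemma hankel_jacobi :
  gen_hankel c m.+2 id id * gen_hankel c m id id =
  gen_hankel c m.+1 id id * gen_hankel c m.+1 (bump_last m) (bump_last m) -
  gen_hankel c m.+1 (bump_last m) id ^+ 2.
Proof.
(* Transposing one factor of the square makes the two factors yield the two off-diagonal Schur
   entries. *)
rewrite expr2 {2}gen_hankel_sym gen_hankel_schur2 !gen_hankel_schur1 //;
  try by move=> i; exact: bump_last_lt.
rewrite /bump_last eqxx.
rewrite -[\det M]/(gen_hankel c m id id).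
move: (gen_hankel c m id id) (schur m m) (schur m m.+1) (schur m.+1 m) (schur m.+1 m.+1).
move=> d x y z w.
by rewrite mulrBr mulrBl (mulrAC d (x * w)) (mulrAC d (y * z)) (mulrACA d x)
  (mulrACA d z) (mulrC z).
Qed.
End Jacobi.

Lemma det_scale_rows_cols (F : fieldType) n (r s : 'I_n -> F) (M : 'M[F]_n) :
  \det (\matrix_(i, j) (r i * s j * M i j)) = (\prod_i (r i * s i)) * \det M.
Proof.
have -> : \matrix_(i, j) (r i * s j * M i j) =
    diag_mx (\row_i r i) *m M *m diag_mx (\row_i s i).
  apply/matrixP => i j; rewrite mul_mx_diag mul_diag_mx !mxE.
  by rewrite mulrAC.
rewrite !det_mulmx !det_diag mulrAC -big_split /=; congr (_ * _).
by apply: eq_bigr => i _; rewrite !mxE.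
Qed.

(* With [v] the cofactors of the last row of the minor [M] of order [n.+1],
   the quadratic form takes at [v] the value [\det M] times the minor of order [n]. *)
Lemma det_pos_def (F : realFieldType) (m : nat -> nat -> F) :
  (forall n (v : 'I_n -> F), (exists i, v i != 0) ->
    0 < \sum_(i < n) \sum_(j < n) v i * v j * m i j) ->
  forall n, 0 < \det (\matrix_(i < n, j < n) m i j).
Proof.
move=> pd; elim=> [|n IHn]; first by rewrite det_mx00 ltr01.
set M := \matrix_(i, j) _.
pose v i := (\adj M) i ord_max.
have vmax : v ord_max = \det (\matrix_(i < n, j < n) m i j).
  rewrite /v mxE /cofactor -signr_odd addnn odd_double expr0 mul1r.
  congr (\det _); apply/matrixP => i j; rewrite !mxE.
  by rewrite !lift_max.
(* The last entry of [v] is the minor of order [n], positive by induction, so [v] is nonzero. *)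
have /pd : exists i, v i != 0 by exists ord_max; rewrite vmax gt_eqF.
have -> : \sum_(i < n.+1) \sum_(j < n.+1) v i * v j * m i j = v ord_max * \det M.
  transitivity (\sum_i v i * (M *m \adj M) i ord_max).
    apply: eq_bigr => i _; rewrite mxE big_distrr /=; apply: eq_bigr => j _.
    by rewrite -mulrA; congr (_ * _); rewrite [RHS]mulrC /v [in RHS]/M [in RHS]mxE.
  rewrite mul_mx_adj (bigD1 ord_max) //= big1 ?addr0.
    by rewrite mxE eqxx mulr1n.
  by move=> i /negbTE ne; rewrite mxE ne mulr0n mulr0.
by rewrite vmax pmulr_rgt0.
Qed.

End HankelDeterminants.

Unset Implicit Arguments.
Set Strict Implicit.

Import GRing.Theory.

(** * Differentiating sums, products and determinants *)

Lemma is_derive_bigsum (I : Type) (r : seq I) (f : I -> R -> R) (df : I -> R) (x : R) :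
  (forall i, is_derive (f i) x (df i)) ->
  is_derive (fun y => (\sum_(i <- r) f i y)%R) x (\sum_(i <- r) df i)%R.
Proof.
intros H; induction r as [|i r IH].
- rewrite big_nil; apply (is_derive_ext (fun _ => 0)); [|apply (is_derive_const (K := R_AbsRing) (V := R_NormedModule))].
  intros y; now rewrite big_nil.
- rewrite big_cons; apply (is_derive_ext (fun y => f i y + (\sum_(i <- r) f i y)%R)).
  + intros y; now rewrite big_cons.
  + exact (is_derive_plus _ _ _ _ _ (H i) IH).
Qed.

Lemma is_lim_bigsum (I : Type) (r : seq I) (f : I -> R -> R) (l : I -> R) (x : Rbar) :
  (forall i, is_lim (f i) x (l i)) ->
  is_lim (fun y => (\sum_(i <- r) f i y)%R) x (\sum_(i <- r) l i)%R.
Proof.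
intros H; induction r as [|i r IH].
- rewrite big_nil; apply (is_lim_ext (fun _ => 0)); [|apply is_lim_const].
  intros y; now rewrite big_nil.
- rewrite big_cons; apply (is_lim_ext (fun y => f i y + (\sum_(i <- r) f i y)%R)).
  + intros y; now rewrite big_cons.
  + now apply (is_lim_plus _ _ _ _ _ _ (H i) IH).
Qed.

(** Leibniz rule by induction on the list; [uniq r] ensures that the test [i == k] selects a single
    factor. *)
Lemma is_derive_bigprod (I : eqType) (r : seq I) (f : I -> R -> R) (df : I -> R) (x : R) :
  uniq r -> (forall i, is_derive (f i) x (df i)) ->
  is_derive (fun y => (\prod_(i <- r) f i y)%R) x
    (\sum_(k <- r) \prod_(i <- r) (if i == k then df i else f i x))%R.
Proof.
move=> ur H; elim: r ur => [_|i r IH /= /andP[ir ur]].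
- rewrite big_nil; apply (is_derive_ext (fun _ => 1)); [|apply (is_derive_const (K := R_AbsRing) (V := R_NormedModule))].
  intros y; now rewrite big_nil.
- apply (is_derive_ext (fun y => f i y * (\prod_(i <- r) f i y)%R)).
  { intros y; now rewrite big_cons. }
  evar_last; [exact (is_derive_mult _ _ _ _ _ (H i) (IH ur) Rmult_comm)|].
  rewrite [RHS]big_cons big_cons eqxx.
  change (df i * (\prod_(j <- r) f j x)%R +
    f i x * (\sum_(k <- r) \prod_(i <- r) (if i == k then df i else f i x))%R = 
    (df i * \prod_(j <- r) (if j == i then df j else f j x) +
    \sum_(j <- r) \prod_(i0 <- (i :: r)) (if i0 == j then df i0 else f i0 x))%R).
  rewrite RplusE !RmultE big_distrr /=; congr (_ * _ + _)%R.
  + apply: eq_big_seq => j jr; case: eqP => // E; by rewrite -E jr in ir.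
  + apply: eq_big_seq => k kr; rewrite big_cons; case: eqP => // E.
    by rewrite E kr in ir.
Qed.

(** The product rule is applied to each term of the expansion over permutations; exchanging the two
    sums regroups the terms by differentiated row. *)
Lemma is_derive_det (n : nat) (f : 'I_n -> 'I_n -> R -> R) (df : 'I_n -> 'I_n -> R)
    (x : R) :
  (forall i j, is_derive (f i j) x (df i j)) ->
  is_derive (fun y => (\det (\matrix_(i, j) f i j y))%R) x
   (\sum_k \det (\matrix_(i, j) (if i == k then df i j else f i j x)))%R.
Proof.
move=> H.
apply (is_derive_ext
  (fun y => (\sum_(s : 'S_n) (-1) ^+ s * \prod_i f i (s i) y)%R)).
{ move=> y; apply: eq_bigr => s _; congr (_ * _)%R.
  by apply: eq_bigr => i _; rewrite mxE. }
evar_last.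
- apply: (is_derive_bigsum _ _ (fun (s : 'S_n) y => ((-1) ^+ s * \prod_i f i (s i) y)%R)) => s.
  apply (is_derive_scal (fun y => (\prod_i f i (s i) y)%R)).
  apply is_derive_bigprod; first exact: index_enum_uniq.
  move=> i; exact: H.
- rewrite [RHS]exchange_big /=; apply: eq_bigr => s _.
  rewrite RmultE big_distrr /=; apply: eq_bigr => k _; congr (_ * _)%R.
  apply: eq_bigr => i _; by rewrite mxE.
Qed.

(* All differentiated rows but the last one repeat the row below them. *)
Lemma is_derive_gen_hankel (c : nat -> R -> R) (m : nat) (b : nat -> nat) (x : R) :
  (forall k, is_derive (c k) x (c (S k) x)) ->
  is_derive (fun y => gen_hankel (c^~ y) m.+1 id b) x
    (gen_hankel (c^~ x) m.+1 (bump_last m) b).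
Proof.
move=> H; evar_last.
- apply: (is_derive_det _ (fun i j => c (i + b j)%N)) => i j; exact: H.
- rewrite (bigD1 ord_max) //= [X in (_ + X)%R]big1 ?addr0.
  + congr (\det _)%R; apply/matrixP => i j; rewrite !mxE /bump_last -val_eqE /=.
    by case: eqP.
  + move=> k nk.
    have km : (k.+1 < m.+1)%N.
      by rewrite ltnS ltn_neqAle -ltnS ltn_ord andbT; exact: nk.
    apply: (determinant_alternate (i1 := k) (i2 := Ordinal km)).
      by rewrite -val_eqE /= neq_ltn ltnSn.
    move=> j; rewrite !mxE eqxx -val_eqE /= gtn_eqF //.
Qed.

(** * Positivity of the Hankel determinants *)

Lemma moment_quadratic_form_pos (a A B t : R) (n : nat) (v : 'I_n -> R) :
  0 < a -> 0 <= A -> 0 < B -> 0 < t -> (exists i, v i != 0)%R ->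
  0 < (\sum_(i < n) \sum_(j < n) v i * v j * moment a A B (i + j) t)%R.
Proof.
move=> Ha HA HB Ht [i0 Hi0].
pose q (m : nat -> R) : R := (\sum_(i < n) \sum_(j < n) v i * v j * m (i + j)%N)%R.
pose h x := q (lower_gamma a ^~ x).
pose p : {poly R} := (\poly_(i < n) (if insub i is Some j then v j else 0))%R.
have px x : p.[x]%R = (\sum_(i < n) v i * pow x i)%R.
  by rewrite horner_poly; apply: eq_bigr => i _; rewrite valK RpowE.
(* Here [h x] is the integral of [p^2] against the gamma density over [[0, x]], increasing from 0 to
   [q (complete_gamma a)]. The form is thus [A] times the full integral plus [B] times the tail
   beyond [t], and it remains to see that this tail is strictly positive. *)
have qE : q (fun k => moment a A B k t) = (A + B) * q (complete_gamma a) - B * h t.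
  rewrite /h /q RminusE !RmultE !big_distrr /= -sumrB; apply: eq_bigr => i _.
  rewrite !big_distrr /= -sumrB; apply: eq_bigr => j _.
  rewrite moment_eq // -?RminusE -?RmultE; ring.
have dh x : is_derive h x (p.[x]%R ^ 2 * (rpow x a * exp (- x))).
  evar_last.
  - apply: (is_derive_bigsum _ _ (fun (i : 'I_n) y =>
      (\sum_(j < n) v i * v j * lower_gamma a (i + j)%N y)%R)) => i.
    apply: (is_derive_bigsum _ _ (fun (j : 'I_n) y =>
      (v i * v j * lower_gamma a (i + j)%N y)%R)) => j.
    apply (is_derive_scal (lower_gamma a (i + j)%N)).
    exact: is_derive_lower_gamma.
  - rewrite px /= Rmult_1_r !RmultE big_distrl /= big_distrl /=.
    apply: eq_bigr => i _; rewrite big_distrr big_distrl /=; apply: eq_bigr => j _.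
    rewrite /gamma_density pow_add -!RmultE. real_eq; move: (x ^ i) (x ^ j) (v i) (v j) (rpow x a) (exp (- x)) => c1 c2 c3 c4 c5 c6; ring.
have dhp x : 0 <= p.[x]%R ^ 2 * (rpow x a * exp (- x)).
  apply Rmult_le_pos; first exact: pow2_ge_0.
  apply Rmult_le_pos; last (left; exact: exp_pos).
  rewrite /rpow; case: Rlt_dec => _ /=; [left; exact: exp_pos|lra].
have hincr x y : x <= y -> h x <= h y.
  move=> xy; apply: (incr_of_derive _ _ _ _ xy dh) => z _; exact: dhp.
have h0 : h 0 = 0.
  rewrite /h /q big1 // => i _; rewrite big1 // => j _.
  by rewrite lower_gamma0 mulr0.
have hlim : is_lim h p_infty (q (complete_gamma a)).
  apply: (is_lim_bigsum _ _ (fun (i : 'I_n) y =>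
      (\sum_(j < n) v i * v j * lower_gamma a (i + j)%N y)%R)) => i.
  apply: (is_lim_bigsum _ _ (fun (j : 'I_n) y =>
      (v i * v j * lower_gamma a (i + j)%N y)%R)) => j.
  apply (is_lim_scal_l (lower_gamma a (i + j)%N) _ _ (complete_gamma a (i + j)%N)).
  exact: is_lim_lower_gamma.
have hle x : h x <= q (complete_gamma a).
  apply: (is_lim_le_loc (fun _ => h x) h p_infty (h x) (q (complete_gamma a))) => //.
  - exists x => y xy; apply: hincr; lra.
  - exact: is_lim_const.
(* Otherwise [h] is constant on [[t, +oo)] and [p] vanishes there. *)
have hlt : h t < q (complete_gamma a).
  apply Rnot_le_lt => le.
  have hconst x : t <= x -> h x = h t.
    move=> tx; have := hle x; have := hincr _ _ tx; lra.
  have rootp x : t < x -> root p x.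
    move=> tx; apply/rootP.
    have d0 : is_derive h x 0.
      apply: (is_derive_ext_loc (fun _ => h t)); last exact: (is_derive_const (K := R_AbsRing) (V := R_NormedModule)).
      have dpos : 0 < x - t by lra.
      exists (mkposreal _ dpos) => y Hy.
      have {}Hy : Rabs (y - x) < x - t by exact: Hy.
      move/Rabs_def2: Hy => Hy; symmetry; apply: hconst; lra.
    have := is_derive_unique _ _ _ (dh x); rewrite (is_derive_unique _ _ _ d0) => /esym E.
    have w : 0 < rpow x a * exp (- x).
      rewrite /rpow; case: Rlt_dec => [? /=|]; last by move=> ?; lra.
      by apply Rmult_lt_0_compat; exact: exp_pos.
    case: (Rmult_integral _ _ E) => [E2|]; last lra.
    exact: (Rsqr_0_uniq _ (eq_trans (Rsqr_pow2 _) E2)).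
  have p0 : p != 0%R.
    apply/eqP => p0; move/eqP: Hi0; apply.
    have := coef_poly n (fun i => if insub i is Some j then v j else 0)%R i0.
    by rewrite -/p p0 coef0 ltn_ord valK.
  (* These [n] distinct points beyond [t] are too many roots for a nonzero polynomial of size at
     most [n]. *)
  pose s := [seq t + 1 + INR i | i <- iota 0 n].
  have : (size s < size p)%N.
    apply: max_poly_roots => //.
    - apply/allP => y /mapP[i _ ->]; apply: rootp; have := pos_INR i; lra.
    - rewrite map_inj_uniq ?iota_uniq // => i j E; apply: INR_eq; lra.
  by rewrite size_map size_iota ltnNge size_poly.
have ht0 : 0 <= h t by rewrite -h0; apply: hincr; lra.
change (0 < q (fun k => moment a A B k t)); rewrite qE.
have : 0 < B * (q (complete_gamma a) - h t) by apply Rmult_lt_0_compat; lra.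
have : 0 <= A * q (complete_gamma a) by apply Rmult_le_pos; lra.
lra.
Qed.

Lemma hankelD_pos (a A B t : R) (n : nat) :
  0 < a -> 0 <= A -> 0 < B -> 0 < t -> 0 < hankelD a A B n t.
Proof.
move=> Ha HA HB Ht; rewrite /hankelD; apply/RltP.
apply: (det_pos_def (m := fun i j => moment a A B (i + j)%N t)) => m v Hv.
apply/RltP; exact: moment_quadratic_form_pos.
Qed.

(** * Scaled determinants and the differential equation *)

Definition scaled_hankelD (a A B : R) (n : nat) (t : R) : R :=
  gen_hankel (scaled_moment a A B ^~ t) n id id.

(** The scaling factor of entry [(i, j)] splits as [r i * s j], hence comes out of the determinant.
    The signs in [r i * s i] cancel, and the exponents [2 i + 1 + a] add up to [n (n + a)] over
    [i < n]. *)
Lemma hankelD_scaled (a A B t : R) (n : nat) : 0 < t ->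
  hankelD a A B n t = Rpower t (INR n * (INR n + a)) * scaled_hankelD a A B n t.
Proof.
move=> Ht.
pose r (i : nat) := (- 1) ^ i * Rpower t (- INR i).
pose s (i : nat) := (- 1) ^ i * Rpower t (- (INR i + 1 + a)).
have -> : scaled_hankelD a A B n t = Rpower t (- (INR n * (INR n + a))) * hankelD a A B n t.
  transitivity ((\prod_(i < n) (r i * s i)) * hankelD a A B n t)%R.
    rewrite /hankelD -det_scale_rows_cols; congr (\det _)%R.
    apply/matrixP => i j; rewrite !mxE /r /s /scaled_moment -!RmultE pow_add plus_INR.
    replace (- (INR i + INR j + 1 + a)) with (- INR i + - (INR j + 1 + a)) by ring.
    rewrite Rpower_plus. real_eq; ring.
  rewrite RmultE; congr (_ * _)%R.
  elim: n => [|n IHn].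
    by rewrite big_ord0 /= Rmult_0_l Ropp_0 Rpower_O.
  rewrite S_INR big_ord_recr /= IHn /r /s -!RmultE.
  replace (- ((INR n + 1) * (INR n + 1 + a))) with
    (- (INR n * (INR n + a)) + (- INR n + - (INR n + 1 + a))) by ring.
  rewrite !Rpower_plus.
  have E : (- 1) ^ n * (- 1) ^ n = 1.
    by rewrite -Rpow_mult_distr Rmult_opp_opp Rmult_1_l pow1.
  real_eq; match goal with |- _ = ?y => transitivity ((- 1) ^ n * (- 1) ^ n * y) end.
    ring.
  by rewrite E Rmult_1_l.
rewrite -Rmult_assoc -Rpower_plus Rplus_opp_r Rpower_O //; ring.
Qed.

Theorem theorem4 (alpha A B t : R) (n : nat) :
  0 < alpha -> 0 <= A -> 0 < B -> 0 < t -> (1 <= n)%nat ->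
  (forall s, 0 < s -> ex_derive (fun u => ln (hankelD alpha A B n u)) s) /\
  ex_derive (fun s => Derive (fun u => ln (hankelD alpha A B n u)) s) t /\
  t ^ 2 * Derive (fun s => Derive (fun u => ln (hankelD alpha A B n u)) s) t =
    - (INR n * (INR n + alpha))
    + hankelD alpha A B (S n) t * hankelD alpha A B (n - 1) t
      / (hankelD alpha A B n t) ^ 2.
Proof.
move=> Ha HA HB Ht; case: n => // m _.
have near s : 0 < s -> locally s (fun u => 0 < u).
  move=> Hs; exact: (open_gt 0 s Hs).
set N := INR m.+1 * (INR m.+1 + alpha).
pose c := scaled_moment alpha A B.
pose h k u := scaled_hankelD alpha A B k u.
pose h1 u := gen_hankel (c^~ u) m.+1 (bump_last m) id.
pose h2 u := gen_hankel (c^~ u) m.+1 (bump_last m) (bump_last m).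
have hpos k u : 0 < u -> 0 < h k u.
  move=> Hu; have := hankelD_pos alpha A B u k Ha HA HB Hu.
  rewrite hankelD_scaled // => H.
  apply: (Rmult_lt_reg_l _ _ _ (exp_pos _)); rewrite Rmult_0_r; exact: H.
have dc u k : 0 < u -> is_derive (c k) u (c k.+1 u).
  move=> Hu; exact: is_derive_scaled_moment.
have dh u : 0 < u -> is_derive (h m.+1) u (h1 u).
  move=> Hu; apply: is_derive_gen_hankel => k; exact: dc.
have dh1 u : 0 < u -> is_derive h1 u (h2 u).
  (* By symmetry the raised row becomes a raised column, so that the row rule applies a second
     time. *)
  move=> Hu; apply: (is_derive_ext (fun y => gen_hankel (c^~ y) m.+1 id (bump_last m))).
    by move=> y; exact: gen_hankel_sym.
  apply: is_derive_gen_hankel => k; exact: dc.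
have dln u : 0 < u ->
    is_derive (fun u => ln (hankelD alpha A B m.+1 u)) u (N / u + h1 u / h m.+1 u).
  (* The factor [t^N] contributes [N ln t], which becomes the term [-N] after two derivatives and
     multiplication by [t^2]. *)
  move=> Hu; apply: (is_derive_ext_loc (fun y => N * ln y + ln (h m.+1 y))).
    apply: filter_imp (near u Hu) => y Hy.
    rewrite hankelD_scaled // ln_mult ?ln_Rpower //; [exact: exp_pos|exact: hpos].
  have := dh u Hu; have := hpos m.+1 u Hu; move: (h m.+1) => g gpos dg.
  auto_derive; first by repeat split => //; eexists; exact: dg.
  rewrite (is_derive_unique _ _ _ dg); field; lra.
split; first by move=> s Hs; eexists; exact: dln.
have ddln : is_derive (fun s => Derive (fun u => ln (hankelD alpha A B m.+1 u)) s) t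
    (- N / t ^ 2 + (h2 t * h m.+1 t - h1 t ^ 2) / h m.+1 t ^ 2).
  apply: (is_derive_ext_loc (fun u => N / u + h1 u / h m.+1 u)).
    apply: filter_imp (near t Ht) => y Hy.
    symmetry; apply: is_derive_unique; exact: dln.
  have := dh t Ht; have := dh1 t Ht; have := hpos m.+1 t Ht.
  move: (h m.+1) (h1) (h2) => g g1 g2 gpos dg1 dg.
  auto_derive; first by repeat split; try lra; eexists; [exact: dg1|exact: dg].
  rewrite (is_derive_unique _ _ _ dg) (is_derive_unique _ _ _ dg1); field; lra.
split; first by eexists; exact: ddln.
have jac : h m.+2 t * h m t = h m.+1 t * h2 t - h1 t ^ 2.
  rewrite /h RpowE RminusE !RmultE; apply: hankel_jacobi.
  rewrite unitmxE unitfE; apply/eqP; apply: Rgt_not_eq; exact: hpos.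
(* With [n = m + 1], the exponents of orders [n + 1] and [n - 1] sum to [2 n (n + alpha) + 2]; the
   excess 2 is the prefactor [t^2] of the claim. *)
have pw : Rpower t (INR m.+2 * (INR m.+2 + alpha)) * Rpower t (INR m * (INR m + alpha))
    = t ^ 2 * Rpower t N ^ 2.
  have -> : t ^ 2 = Rpower t 2 by rewrite -Rpower_pow.
  rewrite /N !S_INR /= Rmult_1_r -!Rpower_plus; congr Rpower; ring.
rewrite (is_derive_unique _ _ _ ddln) subn1 !hankelD_scaled // -/N.
rewrite -!/(h _ t).
have := hpos m.+1 t Ht; have : 0 < Rpower t N by exact: exp_pos.
move: (Rpower t N) pw (h m.+1 t) (h m.+2 t) (h m t) jac => P pw x y z jac HP Hx.
have -> : Rpower t (INR m.+2 * (INR m.+2 + alpha)) * y * (Rpower t (INR m * (INR m + alpha)) * z) =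
    t ^ 2 * P ^ 2 * (y * z) by rewrite -pw; ring.
rewrite jac; field; lra.
Qed.
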